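(* Let $B\subseteq\Lambda$ be a subalgebra such that $\Lambda$ is a finitely generated projective generator as a right $B$-module. Assume furthermore that, for all left $B$-modules $M$ and $N$, the homomorphisms \[\operatorname{Ext}^i_B(M,N)\longrightarrow\operatorname{Ext}^i_\Lambda(\Lambda\otimes_B M,\Lambda\otimes_B N)\] induced by the induction functor $\Lambda\otimes_B-$ are epimorphisms for $i\geq 1$ and isomorphisms for $i\geq 2$. Let $W=\operatorname{Hom}_{B^{\mathrm{op}}}(\Lambda,B)$ be the right dual coring of $\Lambda$, with counit $\varepsilon\colon W\to B$, $f\mapsto f(1)$, and define $\overline{W}:=\ker\varepsilon$. Then $\overline{W}$ is left projectivising.
   Context: Algebras are associative and unital, and subalgebras share the unit. $\operatorname{Hom}_{B^{\mathrm{op}}}$ denotes homomorphisms of right $B$-modules. Right dual coring: if $\Lambda$ is finitely generated projective as a right $B$-module, put $W=\operatorname{Hom}_{B^{\mathrm{op}}}(\Lambda,B)$, a $B$-$B$-bimodule via $(bf)(x)=b f(x)$ and $(fb)(x)=f(bx)$. It carries a coassociative comultiplication $\mu\colon W\to W\otimes_B W$ dual to the multiplication of $\Lambda$ (using the isomorphism $W\otimes_B W\cong\operatorname{Hom}_{B^{\mathrm{op}}}(\Lambda\otimes_B\Lambda,B)$, $f\otimes g\mapsto(x\otimes y\mapsto f(g(x)y))$) with $B$-$B$-bilinear counit $\varepsilon\colon W\to B$, $\varepsilon(f)=f(1)$. A $B$-$B$-bimodule $U$ is called left projectivising if $U\otimes_B X$ is projective as a left $B$-module for each left $B$-module $X$.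 Since $\Lambda$ is projective as a right $B$-module, the induction functor $\Lambda\otimes_B-$ from left $B$-modules to left $\Lambda$-modules is exact, and so induces maps on Ext groups. *)

(* Defs.v *)
From HB Require Import structures.
From mathcomp Require Import all_boot all_order all_algebra.
From mathcomp Require Import generic_quotient ring_quotient boolp freeg.

Set Implicit Arguments.
Unset Strict Implicit.
Unset Printing Implicit Defensive.

Import GRing.Theory.
Local Open Scope ring_scope.
Local Open Scope quotient_scope.

(* Left modules over a ring R are [lmodType R]; right modules over R are      *)
(* [lmodType R^c], where R^c is the opposite ring.                            *)

Section HomGroup.
Variables (R : pzRingType) (U V : lmodType R).
Implicit Types f g h : {linear U -> V}.

HB.instance Definition _ := gen_eqMixin {linear U -> V}.
HB.instance Definition _ := gen_choiceMixin {linear U -> V}.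

Lemma lin_ext f g : f =1 g -> f = g.
Proof.
case: f g => [f [[f1] [f2]]] [g [[g1] [g2]]] /= /funext fg; subst g.
by rewrite (Prop_irrelevance f1 g1) (Prop_irrelevance f2 g2).
Qed.

Definition lin_zero : {linear U -> V} := \0.
Definition lin_add f g : {linear U -> V} := f \+ g.
Definition lin_opp f : {linear U -> V} := \- f.

Fact lin_addA : associative lin_add.
Proof. by move=> f g h; apply: lin_ext => x /=; rewrite addrA. Qed.
Fact lin_addC : commutative lin_add.
Proof. by move=> f g; apply: lin_ext => x /=; rewrite addrC. Qed.
Fact lin_add0 : left_id lin_zero lin_add.
Proof. by move=> f; apply: lin_ext => x /=; rewrite add0r. Qed.
Fact lin_addN : left_inverse lin_zero lin_opp lin_add.
Proof. by move=> f; apply: lin_ext => x /=; rewrite addNr. Qed.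

HB.instance Definition _ :=
  GRing.isZmodule.Build {linear U -> V} lin_addA lin_addC lin_add0 lin_addN.

End HomGroup.

Section LeftModules.
Variable R : pzRingType.

Definition surj (X Y : Type) (f : X -> Y) : Prop := forall y, exists x, f x = y.

Definition projective (P : lmodType R) : Prop :=
  forall (X Y : lmodType R) (g : {linear X -> Y}) (f : {linear P -> Y}),
    surj g -> exists h : {linear P -> X}, forall p, g (h p) = f p.

Definition fin_generated (M : lmodType R) : Prop :=
  exists (n : nat) (e : 'I_n -> M),
    forall x, exists c : 'I_n -> R, x = \sum_i c i *: e i.

(* The functor Hom(G, -) is faithful. *)
Definition generator (G : lmodType R) : Prop :=
  forall (X Y : lmodType R) (g : {linear X -> Y}),
    (exists x, g x != 0) ->
    exists (f : {linear G -> X}) (u : G), g (f u) != 0.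

Definition fg_projective (M : lmodType R) : Prop :=
  fin_generated M /\ projective M.

Record proj_resolution (M : lmodType R) := ProjResolution {
  res_obj :> nat -> lmodType R;
  res_d : forall n, {linear res_obj n.+1 -> res_obj n};
  res_aug : {linear res_obj 0 -> M};
  res_projective : forall n, projective (res_obj n);
  res_aug_surj : surj res_aug;
  res_exact0 : forall x, res_aug x = 0 <-> exists y, res_d 0 y = x;
  res_exactS : forall n x, res_d n x = 0 <-> exists y, res_d n.+1 y = x
}.

End LeftModules.

Section Kernel.
Variables (R : pzRingType) (U V : lmodType R) (f : {linear U -> V}).

Definition ker_pred : {pred U} := fun u => f u == 0.

Fact ker_submod_closed : submod_closed ker_pred.
Proof.
split=> [|a u v]; rewrite !unfold_in ?linear0 // => /eqP fu /eqP fv.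
by rewrite linearP fu fv scaler0 addr0.
Qed.
HB.instance Definition _ := GRing.isSubmodClosed.Build R U ker_pred ker_submod_closed.

Record ker := KerElt { ker_val : U; _ : ker_val \in ker_pred }.
HB.instance Definition _ := [isSub for ker_val].
HB.instance Definition _ := [Choice of ker by <:].
HB.instance Definition _ := [SubChoice_isSubLmodule of ker by <:].

Lemma ker_valP (u : ker) : f (ker_val u) = 0.
Proof. by case: u => u /= /eqP. Qed.

End Kernel.

Section FreeResolution.
Variable R : nzRingType.

Definition free_module (M : lmodType R) : lmodType R := {freeg M / R}.

Section FreeLift.
Variables (M N : lmodType R) (h : M -> N).

Fact free_lift_is_linear : linear (fglift h : free_module M -> N).
Proof.
have hB := lift_is_additive h.
have h0 : fglift h 0 = 0 by have := hB 0 0; rewrite !subrr.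
have hD s t : fglift h (s + t) = fglift h s + fglift h t.
  by rewrite -[t in LHS]opprK -[- t]add0r !hB h0 sub0r opprK.
move=> c s t; rewrite hD; congr (_ + _); rewrite -[s]freeg_sumE.
elim: (dom s) => [|m r IH].
  by rewrite big_nil scaler0 h0 scaler0.
rewrite big_cons scalerDr !hD IH scalerDr; congr (_ + _).
have -> : c *: << coeff m s *g m >> = << (c * coeff m s) *g m >> :> {freeg M / R}.
  by apply/eqP/freeg_eqP => y; rewrite coeffZ !coeffU mulrA.
by rewrite !liftU scalerA.
Qed.

Definition free_lift : {linear free_module M -> N} :=
  HB.pack (fglift h : free_module M -> N)
    (GRing.isLinear.Build _ _ _ _ _ free_lift_is_linear).

Lemma free_liftU m : free_lift (<< m >> : free_module M) = h m.
Proof. by rewrite -[LHS]/(fglift h _) liftU scale1r. Qed.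

End FreeLift.

Lemma free_projective (M : lmodType R) : projective (free_module M).
Proof.
move=> X Y g f g_surj; have [h gh] := choice (fun m : M => g_surj (f << m >>)).
exists (free_lift h) => p; rewrite -[p]freeg_sumE !linear_sum.
apply: eq_bigr => m _.
have -> : << coeff m p *g m >> = coeff m p *: (<< m >> : free_module M).
  by apply/eqP/freeg_eqP => y; rewrite coeffZ !coeffU mul1r.
by rewrite !linearZ free_liftU gh.
Qed.

Definition free_aug (M : lmodType R) : {linear free_module M -> M} := free_lift id.

Lemma free_aug_surj (M : lmodType R) : surj (free_aug M).
Proof. by move=> m; exists << m >>; exact: free_liftU. Qed.

Variable M : lmodType R.

Fixpoint syzygy (n : nat) : lmodType R :=
  if n is m.+1 then ker (free_aug (syzygy m)) else M.

Definition free_d n : {linear free_module (syzygy n.+1) -> free_module (syzygy n)} :=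
  (val : ker (free_aug (syzygy n)) -> free_module (syzygy n)) \o free_aug (syzygy n.+1).

Fact free_exact n x : free_aug (syzygy n) x = 0 <-> exists y, free_d n y = x.
Proof.
split=> [x0|[y <-]]; last exact: ker_valP.
have kx : x \in ker_pred (free_aug (syzygy n)) by apply/eqP.
by have [y y_x] := free_aug_surj (KerElt kx : syzygy n.+1); exists y;
  exact: (congr1 (@ker_val _ _ _ _) y_x).
Qed.

Fact free_exactS n x : free_d n x = 0 <-> exists y, free_d n.+1 y = x.
Proof.
rewrite -free_exact; split=> [x0|x0]; last exact: (congr1 (@ker_val _ _ _ _) x0).
exact: val_inj.
Qed.

(* The resolution of M by the free modules on the elements of its successive *)
(* syzygies.                                                                 *)
Definition free_resolution : proj_resolution M :=
  @ProjResolution R M (fun n => free_module (syzygy n)) free_d (free_aug M)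
    (fun n => @free_projective (syzygy n)) (@free_aug_surj M)
    (@free_exact 0) free_exactS.

End FreeResolution.

Section Ext.
Variables (R : pzRingType) (M : lmodType R) (P : proj_resolution M).
Variables (N : lmodType R) (n : nat).

Definition is_cocycle (f : {linear P n -> N}) : Prop :=
  forall x, f (res_d P n x) = 0.

Definition is_coboundary : {linear P n -> N} -> Prop :=
  match n return {linear P n -> N} -> Prop with
  | 0 => fun f => forall x, f x = 0
  | m.+1 => fun f => exists g : {linear P m -> N}, forall x, f x = g (res_d P m x)
  end.

Definition cocycles : {pred {linear P n -> N}} := fun f => `[< is_cocycle f >].

Fact cocycles_zmod_closed : zmod_closed cocycles.
Proof.
split=> [|f g /asboolP cf /asboolP cg]; first by apply/asboolP.
by apply/asboolP => x /=; rewrite cf cg /= subrr.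
Qed.
HB.instance Definition _ := GRing.isZmodClosed.Build _ cocycles cocycles_zmod_closed.

Record cocycle := Cocycle {
  cocycle_val :> {linear P n -> N};
  cocycle_mem : cocycle_val \in cocycles }.
HB.instance Definition _ := [isSub for cocycle_val].
HB.instance Definition _ := [Choice of cocycle by <:].
HB.instance Definition _ := [SubChoice_isSubZmodule of cocycle by <:].

Lemma cocycleP (f : cocycle) x : f (res_d P n x) = 0.
Proof. by case: f => f /= /asboolP. Qed.

Definition coboundaries : {pred cocycle} := fun f => `[< is_coboundary f >].

Fact is_coboundary0 : is_coboundary 0.
Proof. by rewrite /is_coboundary; case: (n) => // m; exists 0. Qed.

Fact is_coboundaryB f g :
  is_coboundary f -> is_coboundary g -> is_coboundary (f - g).
Proof.
move: f g; rewrite /is_coboundary; case: (n) => [|m] f g.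
  by move=> cf cg x /=; rewrite cf cg /= subrr.
by move=> [a fa] [b gb]; exists (a - b) => x /=; rewrite fa gb.
Qed.

Fact coboundaries_zmod_closed : zmod_closed coboundaries.
Proof.
split=> [|f g /asboolP cf /asboolP cg]; apply/asboolP.
  exact: is_coboundary0.
exact: is_coboundaryB.
Qed.
HB.instance Definition _ :=
  GRing.isZmodClosed.Build _ coboundaries coboundaries_zmod_closed.

(* Ext^n(M, N), computed from the projective resolution P of M. *)
Definition Ext : Type := Quotient.quot coboundaries.
HB.instance Definition _ := GRing.Zmodule.on Ext.

Definition ext_class (f : cocycle) : Ext := \pi_(Quotient.quot coboundaries) f.

End Ext.

Record bimodule (A B : pzRingType) := Bimodule {
  bimod_left :> lmodType A;
  ract : bimod_left -> B -> bimod_left;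
  ractDl : forall u v b, ract (u + v) b = ract u b + ract v b;
  ractDr : forall u b c, ract u (b + c) = ract u b + ract u c;
  ractM : forall u b c, ract u (b * c) = ract (ract u b) c;
  ract1 : forall u, ract u 1 = u;
  ractZ : forall a u b, ract (a *: u) b = a *: ract u b
}.

Section RightModule.
Variables (A B : pzRingType) (U : bimodule A B).

(* U as a right B-module. *)
Definition rmod : Type := U.
HB.instance Definition _ := GRing.Zmodule.on rmod.

Let rscale (b : B^c) (u : rmod) : rmod := ract (u : U) b.

Fact rscaleA a b u : rscale a (rscale b u) = rscale (a * b) u.
Proof. by rewrite /rscale -ractM. Qed.
Fact rscale1 : left_id 1 rscale.
Proof. by move=> u; exact: ract1. Qed.
Fact rscaleDr : right_distributive rscale +%R.
Proof. by move=> b u v; exact: ractDl. Qed.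
Fact rscaleDl u : {morph rscale^~ u : a b / a + b}.
Proof. by move=> a b; exact: ractDr. Qed.

HB.instance Definition _ :=
  GRing.Zmodule_isLmodule.Build B^c rmod rscaleA rscale1 rscaleDr rscaleDl.

End RightModule.

Section Tensor.
Variables (A B : pzRingType) (U : bimodule A B) (X : lmodType B).

Inductive tensor_rel : {freeg (U * X)%type} -> Prop :=
| TensorRel0 : tensor_rel 0
| TensorRelB s t : tensor_rel s -> tensor_rel t -> tensor_rel (s - t)
| TensorRelDl u v x : tensor_rel (<< (u + v, x) >> - (<< (u, x) >> + << (v, x) >>))
| TensorRelDr u x y : tensor_rel (<< (u, x + y) >> - (<< (u, x) >> + << (u, y) >>))
| TensorRelM u b x : tensor_rel (<< (ract u b, x) >> - << (u, b *: x) >>).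

Definition tensor_rels : {pred {freeg (U * X)%type}} := fun t => `[< tensor_rel t >].

Fact tensor_rels_zmod_closed : zmod_closed tensor_rels.
Proof.
split=> [|s t /asboolP hs /asboolP ht]; apply/asboolP; first exact: TensorRel0.
exact: TensorRelB.
Qed.
HB.instance Definition _ :=
  GRing.isZmodClosed.Build _ tensor_rels tensor_rels_zmod_closed.

(* The tensor product of U and X over B. *)
Definition tensor : Type := Quotient.quot tensor_rels.
HB.instance Definition _ := GRing.Zmodule.on tensor.

Definition tens (u : U) (x : X) : tensor := \pi_(Quotient.quot tensor_rels) << (u, x) >>.

Lemma tens_pi_eq (s t : {freeg (U * X)%type}) : tensor_rel (s - t) ->
  \pi_(Quotient.quot tensor_rels) s = \pi_(Quotient.quot tensor_rels) t.
Proof. by move=> h; apply/eqP; rewrite -Quotient.idealrBE; apply/asboolP. Qed.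

Lemma tensDl u v x : tens (u + v) x = tens u x + tens v x.
Proof. by rewrite /tens -[RHS]raddfD; apply: tens_pi_eq; exact: TensorRelDl. Qed.

Lemma tensDr u x y : tens u (x + y) = tens u x + tens u y.
Proof. by rewrite /tens -[RHS]raddfD; apply: tens_pi_eq; exact: TensorRelDr. Qed.

Lemma tensM u b x : tens (ract u b) x = tens u (b *: x).
Proof. by apply: tens_pi_eq; exact: TensorRelM. Qed.

Lemma tens0l x : tens 0 x = 0.
Proof. by apply: (addIr (tens 0 x)); rewrite -tensDl !add0r. Qed.

Lemma tens0r u : tens u 0 = 0.
Proof. by apply: (addIr (tens u 0)); rewrite -tensDr !add0r. Qed.

Lemma tensNl u x : tens (- u) x = - tens u x.
Proof. by apply/eqP; rewrite -addr_eq0 -tensDl addNr tens0l. Qed.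

Lemma tensNr u x : tens u (- x) = - tens u x.
Proof. by apply/eqP; rewrite -addr_eq0 -tensDr addNr tens0r. Qed.

Lemma tensor_sum (t : tensor) : exists s : seq (U * X), t = \sum_(p <- s) tens p.1 p.2.
Proof.
elim/quotW: t => t; rewrite -[t]freeg_sumE raddf_sum /=.
elim: (dom t) => [|p r [s IH]]; first by exists [::]; rewrite !big_nil.
suff [s' hs'] : exists s' : seq (U * X),
    \pi_(Quotient.quot tensor_rels) << coeff p t *g p >>
    = \sum_(q <- s') tens q.1 q.2 :> tensor.
  by exists (s' ++ s); rewrite big_cons big_cat -IH -hs'.
have nat_case (k : nat) q : \pi_(Quotient.quot tensor_rels) << (k%:Z) *g q >>
    = \sum_(q <- nseq k q) tens q.1 q.2 :> tensor.
  rewrite big_nseq iter_addr_0.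
  have -> : << k%:Z *g q >> = << q >> *+ k by rewrite freegU_muln natz.
  by rewrite raddfMn; case: q.
case: (coeff p t) => k; first by exists (nseq k p); exact: nat_case.
exists (nseq k.+1 (- p.1, p.2)); rewrite NegzE -freegUN raddfN /= nat_case.
by rewrite -[_ :: nseq _ _]/(nseq k.+1 _) !big_nseq !iter_addr_0 /fst /snd tensNl mulNrn.
Qed.

Section Lift.
Variables (V : zmodType) (f : U -> X -> V).
Hypothesis fDl : forall u v x, f (u + v) x = f u x + f v x.
Hypothesis fDr : forall u x y, f u (x + y) = f u x + f u y.
Hypothesis fM : forall u b x, f (ract u b) x = f u (b *: x).

Let F : {freeg (U * X)%type} -> V := fglift (fun p => f p.1 p.2 : zmodule V).

Let FB s t : F (s - t) = F s - F t.
Proof. exact: (lift_is_additive (fun p => f p.1 p.2 : zmodule V)). Qed.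

Let FU u x : F << (u, x) >> = f u x.
Proof. by rewrite /F liftU /= scale1r. Qed.

Let F0 : F 0 = 0.
Proof. by have := FB 0 0; rewrite !subrr. Qed.

Let FD s t : F (s + t) = F s + F t.
Proof. by rewrite -[t in LHS]opprK -[- t]add0r !FB F0 sub0r opprK. Qed.

Let F_rel t : tensor_rel t -> F t = 0.
Proof.
elim=> [|{}s {}t _ hs _ ht|u v x|u x y|u b x].
- exact: F0.
- by rewrite FB hs ht subrr.
- by rewrite FB FD !FU fDl subrr.
- by rewrite FB FD !FU fDr subrr.
- by rewrite FB !FU fM subrr.
Qed.

Definition tensor_lift (t : tensor) : V := F (repr t).

Let tensor_lift_pi s : tensor_lift (\pi_(Quotient.quot tensor_rels) s) = F s.
Proof.
apply/eqP; rewrite -subr_eq0 -FB; apply/eqP/F_rel/asboolP.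
by have := Quotient.idealrBE tensor_rels (repr (\pi_(Quotient.quot tensor_rels) s)) s;
  rewrite reprK eqxx.
Qed.

Lemma tensor_lift_tens u x : tensor_lift (tens u x) = f u x.
Proof. by rewrite /tens tensor_lift_pi FU. Qed.

Lemma tensor_liftD s t : tensor_lift (s + t) = tensor_lift s + tensor_lift t.
Proof.
elim/quotW: s => s; elim/quotW: t => t.
by rewrite -[in LHS]raddfD !tensor_lift_pi FD.
Qed.

End Lift.

Lemma tensor_elim (Q : tensor -> Prop) :
  Q 0 -> (forall s t, Q s -> Q t -> Q (s + t)) -> (forall u x, Q (tens u x)) ->
  forall t, Q t.
Proof.
move=> Q0 QD Qt t; have [s ->] := tensor_sum t.
by apply: big_ind => // -[u x] _; exact: Qt.
Qed.

Fact tensor_scale_subproof a :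
  [/\ forall u v x, tens (a *: (u + v)) x = tens (a *: u) x + tens (a *: v) x,
      forall u x y, tens (a *: u) (x + y) = tens (a *: u) x + tens (a *: u) y &
      forall u b x, tens (a *: ract u b) x = tens (a *: u) (b *: x)].
Proof.
split=> *; first by rewrite scalerDr tensDl.
  exact: tensDr.
by rewrite -ractZ tensM.
Qed.

Definition tensor_scale (a : A) : tensor -> tensor :=
  tensor_lift (fun u x => tens (a *: u) x).

Lemma tensor_scale_tens a u x : tensor_scale a (tens u x) = tens (a *: u) x.
Proof. by have [h1 h2 h3] := tensor_scale_subproof a; exact: tensor_lift_tens. Qed.

Fact tensor_scaleDr : right_distributive tensor_scale +%R.
Proof.
by move=> a s t; have [h1 h2 h3] := tensor_scale_subproof a; exact: tensor_liftD.
Qed.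

Let tensor_scale0 a : tensor_scale a 0 = 0.
Proof. by apply: (addIr (tensor_scale a 0)); rewrite -tensor_scaleDr !add0r. Qed.

Fact tensor_scaleA a b t : tensor_scale a (tensor_scale b t) = tensor_scale (a * b) t.
Proof.
elim/tensor_elim: t => [|s t hs ht|u x]; first by rewrite !tensor_scale0.
  by rewrite !tensor_scaleDr hs ht.
by rewrite !tensor_scale_tens scalerA.
Qed.

Fact tensor_scale1 : left_id 1 tensor_scale.
Proof.
move=> t; elim/tensor_elim: t => [|s t hs ht|u x]; first exact: tensor_scale0.
  by rewrite tensor_scaleDr hs ht.
by rewrite tensor_scale_tens scale1r.
Qed.

Fact tensor_scaleDl t : {morph tensor_scale^~ t : a b / a + b}.
Proof.
move=> a b; elim/tensor_elim: t => [|s t hs ht|u x].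
- by rewrite !tensor_scale0 addr0.
- by rewrite !tensor_scaleDr hs ht addrACA.
- by rewrite !tensor_scale_tens scalerDl tensDl.
Qed.

HB.instance Definition _ := GRing.Zmodule_isLmodule.Build A tensor
  tensor_scaleA tensor_scale1 tensor_scaleDr tensor_scaleDl.

Lemma tensZ a u x : a *: tens u x = tens (a *: u) x.
Proof. exact: tensor_scale_tens. Qed.

Section LinearLift.
Variables (V : lmodType A) (f : U -> X -> V).
Hypothesis fDl : forall u v x, f (u + v) x = f u x + f v x.
Hypothesis fDr : forall u x y, f u (x + y) = f u x + f u y.
Hypothesis fM : forall u b x, f (ract u b) x = f u (b *: x).
Hypothesis fZ : forall a u x, f (a *: u) x = a *: f u x.

Fact tensor_lift_is_linear : linear (tensor_lift f).
Proof.
have fD := tensor_liftD fDl fDr fM.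
move=> a s t; rewrite fD; congr (_ + _).
have f0 : tensor_lift f 0 = 0.
  by apply: (addIr (tensor_lift f 0)); rewrite -fD !add0r.
elim/tensor_elim: s => [|s s' hs hs'|u x].
- by rewrite scaler0 f0 scaler0.
- by rewrite scalerDr !fD hs hs' scalerDr.
- by rewrite tensZ !(tensor_lift_tens fDl fDr fM).
Qed.

Definition tensor_linear : {linear tensor -> V} :=
  HB.pack (tensor_lift f) (GRing.isLinear.Build _ _ _ _ _ tensor_lift_is_linear).

Lemma tensor_linear_tens u x : tensor_linear (tens u x) = f u x.
Proof. exact: tensor_lift_tens. Qed.

End LinearLift.
End Tensor.

Section TensorMap.
Variables (A B : pzRingType) (U : bimodule A B).

Section Map.
Variables (X Y : lmodType B) (f : {linear X -> Y}).

Fact tensor_map_subproof :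
  [/\ forall u v x, tens (u + v) (f x) = tens u (f x) + tens v (f x) :> tensor U Y,
      forall u x y, tens u (f (x + y)) = tens u (f x) + tens u (f y) :> tensor U Y,
      forall u b x, tens (ract u b) (f x) = tens u (f (b *: x)) :> tensor U Y &
      forall a u x, tens (a *: u) (f x) = a *: tens u (f x) :> tensor U Y].
Proof.
split=> *; first exact: tensDl.
- by rewrite linearD tensDr.
- by rewrite linearZ tensM.
- by rewrite tensZ.
Qed.

(* The homomorphism induced by f on U (x)_B X. *)
Definition tensor_map : {linear tensor U X -> tensor U Y} :=
  let: And4 h1 h2 h3 h4 := tensor_map_subproof in tensor_linear h1 h2 h3 h4.

Lemma tensor_map_tens u x : tensor_map (tens u x) = tens u (f x).
Proof.
by rewrite /tensor_map; case: tensor_map_subproof => *; rewrite tensor_linear_tens.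
Qed.

End Map.

Lemma tensor_lin_ext (X : lmodType B) (V : lmodType A)
    (g h : {linear tensor U X -> V}) :
  (forall u x, g (tens u x) = h (tens u x)) -> forall t, g t = h t.
Proof.
move=> gh; apply: tensor_elim => [|s t hs ht|]; last exact: gh.
  by rewrite !linear0.
by rewrite !linearD hs ht.
Qed.

End TensorMap.

Section Extension.
Variables (B L : pzRingType) (iota : {rmorphism B -> L}).

(* L as an L-B-bimodule. *)
Definition ext_bimodule : bimodule L B.
Proof.
refine (@Bimodule L B L^o (fun x b => x * iota b) _ _ _ _ _).
- by move=> u v b; rewrite mulrDl.
- by move=> u b c; rewrite rmorphD mulrDr.
- by move=> u b c; rewrite rmorphM mulrA.
- by move=> u; rewrite rmorph1 mulr1.
- by move=> a u b; rewrite /GRing.scale /= mulrA.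
Defined.

Definition induction (X : lmodType B) : lmodType L := tensor ext_bimodule X.

Definition induction_map (X Y : lmodType B) (f : {linear X -> Y}) :
  {linear induction X -> induction Y} := tensor_map ext_bimodule f.

End Extension.

Definition inclusion (k : comNzRingType) (L : algType k) (S : {pred L})
  (B : subAlgType S) : {rmorphism B -> L} := (val : B -> L).

(* B as a B-B-bimodule. *)
Definition regular_bimodule (B : pzRingType) : bimodule B B :=
  ext_bimodule (idfun : {rmorphism B -> B}).

Section RightDual.
Variables (B L : pzRingType) (iota : {rmorphism B -> L}).

(* Hom of right B-modules from L to B. *)
Definition right_dual_type : Type :=
  {linear rmod (ext_bimodule iota) -> rmod (regular_bimodule B)}.
HB.instance Definition _ := GRing.Zmodule.on right_dual_type.

Definition dual_app (f : right_dual_type) (x : L) : B :=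
  GRing.Linear.sort f (x : rmod (ext_bimodule iota)).

Lemma dual_app_ext f g : dual_app f =1 dual_app g -> f = g.
Proof. by move=> fg; apply: (@lin_ext _ _ _ f g) => x; exact: fg. Qed.

Lemma dual_appD f x y : dual_app f (x + y) = dual_app f x + dual_app f y.
Proof. exact: (linearD (f : {linear _ -> _})). Qed.

Lemma dual_appM f x b : dual_app f (x * iota b) = dual_app f x * b.
Proof. exact: (linearZ_LR (f : {linear rmod (ext_bimodule iota) -> rmod (regular_bimodule B)}) (b : B^c) x). Qed.

Section Build.
Variables (h : L -> B).
Hypothesis hD : forall x y, h (x + y) = h x + h y.
Hypothesis hM : forall x b, h (x * iota b) = h x * b.

Let h' : rmod (ext_bimodule iota) -> rmod (regular_bimodule B) := h.

Fact dual_build_is_linear : linear h'.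
Proof. by move=> b x y; rewrite /h' hD; congr (_ + _); exact: hM. Qed.

Definition dual_build : right_dual_type :=
  HB.pack_for {linear rmod (ext_bimodule iota) -> rmod (regular_bimodule B)} h'
    (GRing.isLinear.Build _ _ _ _ _ dual_build_is_linear).

End Build.

Definition dual_scale (b : B) (f : right_dual_type) : right_dual_type.
Proof.
refine (@dual_build (fun x => b * dual_app f x) _ _) => [x y|x c].
- by rewrite dual_appD mulrDr.
- by rewrite dual_appM mulrA.
Defined.

Definition dual_ract (f : right_dual_type) (b : B) : right_dual_type.
Proof.
refine (@dual_build (fun x => dual_app f (iota b * x)) _ _) => [x y|x c].
- by rewrite mulrDr dual_appD.
- by rewrite mulrA dual_appM.
Defined.

Fact dual_scaleA a b f : dual_scale a (dual_scale b f) = dual_scale (a * b) f.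
Proof. by apply: dual_app_ext => x; exact: mulrA. Qed.
Fact dual_scale1 : left_id 1 dual_scale.
Proof. by move=> f; apply: dual_app_ext => x; exact: mul1r. Qed.
Fact dual_scaleDr : right_distributive dual_scale +%R.
Proof. by move=> b f g; apply: dual_app_ext => x; exact: mulrDr. Qed.
Fact dual_scaleDl f : {morph dual_scale^~ f : a b / a + b}.
Proof. by move=> a b; apply: dual_app_ext => x; exact: mulrDl. Qed.

HB.instance Definition _ := GRing.Zmodule_isLmodule.Build B right_dual_type
  dual_scaleA dual_scale1 dual_scaleDr dual_scaleDl.

(* Only the bimodule and the counit of the dual coring are needed here. *)
Definition right_dual : bimodule B B.
Proof.
refine (@Bimodule B B right_dual_type dual_ract _ _ _ _ _).
- by move=> f g b; exact: dual_app_ext.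
- by move=> f b c; apply: dual_app_ext => x;
    rewrite -[LHS]/(dual_app f _) rmorphD mulrDl dual_appD.
- by move=> f b c; apply: dual_app_ext => x;
    rewrite -[LHS]/(dual_app f _) rmorphM -mulrA.
- by move=> f; apply: dual_app_ext => x;
    rewrite -[LHS]/(dual_app f _) rmorph1 mul1r.
- by move=> a f b; exact: dual_app_ext.
Defined.

Definition counit (f : right_dual) : regular_bimodule B := dual_app f 1.

Fact counit_is_linear : linear counit.
Proof. by []. Qed.
HB.instance Definition _ := GRing.isLinear.Build B right_dual (regular_bimodule B)
  *:%R counit counit_is_linear.

Fact counit_ract f b : counit (ract f b) = ract (counit f) b.
Proof.
by rewrite /= /counit -[LHS]/(dual_app f (iota b * 1)) mulr1 -[iota b]mul1r dual_appM.
Qed.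

End RightDual.

Section KernelBimodule.
Variables (A B : pzRingType) (U V : bimodule A B) (f : {linear U -> V}).
Hypothesis f_ract : forall u b, f (ract u b) = ract (f u) b.

Fact ker_ract_subproof (u : ker f) b : ract (ker_val u) b \in ker_pred f.
Proof.
case: u => u /= fu; rewrite unfold_in f_ract (eqP fu).
by apply/eqP; apply: (addIr (ract 0 b)); rewrite -ractDl !add0r.
Qed.

Definition ker_bimodule : bimodule A B.
Proof.
refine (@Bimodule A B (ker f) (fun u b => KerElt (ker_ract_subproof u b)) _ _ _ _ _).
- by move=> u v b; apply: val_inj; exact: ractDl.
- by move=> u b c; apply: val_inj; exact: ractDr.
- by move=> u b c; apply: val_inj; exact: ractM.
- by move=> u; apply: val_inj; exact: ract1.
- by move=> a u b; apply: val_inj; exact: ractZ.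
Defined.

End KernelBimodule.

Definition counit_kernel (B L : pzRingType) (iota : {rmorphism B -> L}) :
  bimodule B B := ker_bimodule (@counit_ract B L iota).

Definition left_projectivising (B : pzRingType) (U : bimodule B B) : Prop :=
  forall X : lmodType B, projective (tensor U X).

Section InducedResolution.
Variables (B L : pzRingType) (iota : {rmorphism B -> L}).
Local Notation LB := (rmod (ext_bimodule iota)).

(* Induction is left adjoint to restriction of scalars. *)
Section Restriction.
Variable Y : lmodType L.
Definition restriction_type : Type := Y.
HB.instance Definition _ := GRing.Zmodule.on restriction_type.
Let rs (b : B) (y : restriction_type) : restriction_type := iota b *: (y : Y).
Fact rsA a b y : rs a (rs b y) = rs (a * b) y.
Proof. by rewrite /rs scalerA rmorphM. Qed.
Fact rs1 : left_id 1 rs.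
Proof. by move=> y; rewrite /rs rmorph1 scale1r. Qed.
Fact rsDr : right_distributive rs +%R.
Proof. by move=> b y z; rewrite /rs scalerDr. Qed.
Fact rsDl y : {morph rs^~ y : a b / a + b}.
Proof. by move=> a b; rewrite /rs rmorphD scalerDl. Qed.
HB.instance Definition _ := GRing.Zmodule_isLmodule.Build B restriction_type
  rsA rs1 rsDr rsDl.
Definition restriction : lmodType B := restriction_type.
End Restriction.

Section Adjunction.
Variables (P : lmodType B) (Y : lmodType L).

Definition unit_fun (g : {linear induction iota P -> Y}) (p : P) : restriction Y :=
  g (tens (1 : ext_bimodule iota) p).

Fact unit_fun_is_linear g : linear (unit_fun g).
Proof.
move=> b p q; rewrite /unit_fun tensDr linearD; congr (_ + _).
rewrite -tensM /= -[RHS]linearZ tensZ; congr (g (tens _ _)).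
by rewrite /GRing.scale /= mul1r mulr1.
Qed.

Definition adj_unit (g : {linear induction iota P -> Y}) : {linear P -> restriction Y} :=
  HB.pack (unit_fun g) (GRing.isLinear.Build _ _ _ _ _ (unit_fun_is_linear g)).

Variable h : {linear P -> restriction Y}.
Let hf (x : ext_bimodule iota) (p : P) : Y := (x : L) *: (h p : Y).

Definition adj_counit : {linear induction iota P -> Y}.
Proof.
refine (@tensor_linear L B (ext_bimodule iota) P Y hf _ _ _ _); rewrite /hf.
- by move=> x y p; exact: scalerDl.
- by move=> x p q; rewrite linearD; exact: scalerDr.
- by move=> x b p; rewrite linearZ; exact/esym/scalerA.
- by move=> a x p; exact/esym/scalerA.
Defined.

Lemma adj_counit_tens x p : adj_counit (tens x p) = (x : L) *: (h p : Y).
Proof. exact: tensor_linear_tens. Qed.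

End Adjunction.

Lemma induction_projective (P : lmodType B) : projective P -> projective (induction iota P).
Proof.
move=> projP X Y g f g_surj.
have g_lin : linear (g : restriction X -> restriction Y).
  by move=> b x y; exact: (linearP g (iota b) x y).
pose g' : {linear restriction X -> restriction Y} :=
  HB.pack (g : restriction X -> restriction Y) (GRing.isLinear.Build _ _ _ _ _ g_lin).
have [h gh] := projP _ _ g' (adj_unit f) g_surj.
exists (adj_counit h).
apply: (@tensor_lin_ext _ _ _ _ _ (g \o adj_counit h)) => x p.
rewrite -[LHS]/(g (adj_counit h (tens x p))) adj_counit_tens linearZ -[g (h p)]/(g' (h p)) gh.
rewrite /= /unit_fun -linearZ tensZ; congr (f (tens _ _)).
by rewrite /GRing.scale /= mulr1.
Qed.

Lemma dual_basis : fg_projective LB ->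
  exists (n : nat) (e : 'I_n -> L) (phi : 'I_n -> right_dual iota),
    forall x, x = \sum_i e i * iota (dual_app (phi i) x).
Proof.
move=> [[n [e gen_e]] projL].
pose F := {ffun 'I_n -> B^c^o}.
pose g (c : F) : LB := \sum_i (c i : B^c) *: e i.
have g_lin : linear g.
  move=> a c d; rewrite /g scaler_sumr -big_split; apply: eq_bigr => i _.
  by rewrite !ffunE scalerDl scalerA.
pose g' : {linear F -> LB} := HB.pack g (GRing.isLinear.Build _ _ _ _ _ g_lin).
have g_surj : surj g'.
  move=> x; have [c ->] := gen_e x; exists [ffun i => c i].
  by apply: eq_bigr => i _; rewrite ffunE.
have [h gh] := projL _ _ g' (idfun : {linear LB -> LB}) g_surj.
have hD i (x y : L) : (h x i + h y i : B) = h (x + y : L) i.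
  by rewrite (linearD h (x : LB) y) ffunE.
have hM i (x : L) b : (h (x * iota b)%R i : B) = (h x i : B) * b.
  have -> : h (x * iota b)%R = (b : B^c) *: h (x : LB) by exact: linearZ_LR.
  by rewrite ffunE.
exists n, e, (fun i => dual_build (fun x y => esym (hD i x y)) (hM i)) => x.
by rewrite -[LHS](gh x).
Qed.

Lemma induction_exact (X Y Z : lmodType B) (f : {linear X -> Y}) (g : {linear Y -> Z}) :
  fg_projective LB -> (forall y, g y = 0 <-> exists x, f x = y) ->
  forall t, induction_map iota g t = 0 <-> exists s, induction_map iota f s = t.
Proof.
move=> /dual_basis[n [e [phi e_phi]]] fg_exact t; split; last first.
  move=> [s <-]; have gf0 x : g (f x) = 0 by apply/fg_exact; exists x.
  pose c : {linear induction iota X -> induction iota Z} :=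
    induction_map iota g \o induction_map iota f.
  apply: (@tensor_lin_ext _ _ _ _ _ c \0) => u x.
  by rewrite /= !tensor_map_tens gf0 tens0r.
pose psi (W : lmodType B) i : induction iota W -> W :=
  tensor_lift (fun (x : ext_bimodule iota) w => dual_app (phi i) x *: w).
have psi_h (W : lmodType B) i : [/\ forall u v (x : W),
     dual_app (phi i) (u + v) *: x = dual_app (phi i) u *: x + dual_app (phi i) v *: x,
   forall u (x y : W),
     dual_app (phi i) u *: (x + y) = dual_app (phi i) u *: x + dual_app (phi i) u *: y &
   forall u b (x : W), dual_app (phi i) (u * iota b) *: x = dual_app (phi i) u *: (b *: x)].
  by split=> *; rewrite ?dual_appD ?scalerDl ?scalerDr ?dual_appM ?scalerA.
have psiD W i u v : psi W i (u + v) = psi W i u + psi W i v.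
  by have [h1 h2 h3] := psi_h W i; exact: tensor_liftD.
have psi_tens W i u x : psi W i (tens u x) = dual_app (phi i) u *: x.
  by have [h1 h2 h3] := psi_h W i; exact: tensor_lift_tens.
have psi0 W i : psi W i 0 = 0.
  by apply: (addIr (psi W i 0)); rewrite -psiD !add0r.
have psi_nat i u : g (psi Y i u) = psi Z i (induction_map iota g u).
  elim/tensor_elim: u => [|s u hs hu|u y].
  - by rewrite linear0 !psi0 linear0.
  - by rewrite linearD !psiD linearD hs hu.
  - by rewrite tensor_map_tens !psi_tens linearZ.
have psi_sum u : u = \sum_i tens (e i : ext_bimodule iota) (psi Y i u).
  elim/tensor_elim: u => [|s u hs hu|u y].
  - by rewrite big1 // => i _; rewrite psi0 tens0r.
  - rewrite {1}hs {1}hu -big_split; apply: eq_bigr => i _.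
    by rewrite psiD tensDr.
  - under eq_bigr => i _ do rewrite psi_tens -tensM.
    rewrite {1}(e_phi u); elim: (index_enum _) => [|i r IH].
      by rewrite !big_nil tens0l.
    by rewrite !big_cons tensDl IH.
move=> gt0.
have lift_psi i : exists x, f x = psi Y i t.
  by apply/fg_exact; rewrite psi_nat gt0 psi0.
have [x fx] := choice lift_psi.
exists (\sum_i tens (e i : ext_bimodule iota) (x i)).
rewrite linear_sum [RHS]psi_sum; apply: eq_bigr => i _.
by rewrite -fx; exact: tensor_map_tens.
Qed.

Lemma induction_surj (X Y : lmodType B) (f : {linear X -> Y}) :
  surj f -> surj (induction_map iota f).
Proof.
move=> f_surj; apply: tensor_elim => [|s t [s' <-] [t' <-]|u y].
- by exists 0; rewrite linear0.
- by exists (s' + t'); rewrite linearD.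
- by have [x <-] := f_surj y; exists (tens u x); exact: tensor_map_tens.
Qed.

Definition induced_resolution (hL : fg_projective LB) (M : lmodType B)
    (P : proj_resolution M) : proj_resolution (induction iota M) :=
  @ProjResolution L (induction iota M) (fun n => induction iota (P n))
    (fun n => induction_map iota (res_d P n)) (induction_map iota (res_aug P))
    (fun n => induction_projective (@res_projective _ _ P n))
    (induction_surj (@res_aug_surj _ _ P))
    (induction_exact hL (@res_exact0 _ _ P))
    (fun n => induction_exact hL (@res_exactS _ _ P n)).

Section ExtInduction.
Variables (hL : fg_projective LB) (M : lmodType B) (P : proj_resolution M).
Variables (N : lmodType B) (n : nat).
Local Notation IP := (induced_resolution hL P).
Local Notation IN := (induction iota N).

Fact induction_cocycle_subproof (f : cocycle P N n) :
  (induction_map iota f : {linear IP n -> IN}) \in @cocycles _ _ IP IN n.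
Proof.
apply/asboolP; pose c : {linear IP n.+1 -> IN} :=
  (induction_map iota f : {linear IP n -> IN}) \o res_d IP n.
apply: (@tensor_lin_ext _ _ _ _ _ c \0) => u x.
by rewrite /= !tensor_map_tens cocycleP tens0r.
Qed.

Definition induction_cocycle (f : cocycle P N n) : cocycle IP IN n :=
  Cocycle (induction_cocycle_subproof f).

(* Ext^n_B(M, N) -> Ext^n_L(L (x)_B M, L (x)_B N), where the target is computed *)
(* from the projective resolution L (x)_B P of L (x)_B M.                     *)
Definition ext_induction (x : Ext P N n) : Ext IP IN n :=
  ext_class (induction_cocycle (repr x)).

Fact induction_coboundary (f : {linear P n -> N}) :
  is_coboundary f ->
  is_coboundary (induction_map iota f : {linear IP n -> IN}).
Proof.
move: f; rewrite /is_coboundary; case: (n) => [|m] f.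
  by move=> f0; apply: (@tensor_lin_ext _ _ _ _ _ (induction_map iota f) \0) => u x;
    rewrite tensor_map_tens f0 tens0r.
move=> [g fg]; exists (induction_map iota g).
apply: (@tensor_lin_ext _ _ _ _ _ (induction_map iota f)
  (induction_map iota g \o induction_map iota (res_d P m))) => u x.
by rewrite /= !tensor_map_tens fg.
Qed.

Fact induction_cocycleB (f g : cocycle P N n) :
  induction_cocycle (f - g) = induction_cocycle f - induction_cocycle g.
Proof.
apply/val_inj/lin_ext; apply: (@tensor_lin_ext _ _ _ _ _ (induction_map iota (f - g))
  (induction_map iota f - induction_map iota g)) => u x.
rewrite -[RHS]/(induction_map iota f (tens u x) - induction_map iota g (tens u x)).
by rewrite !tensor_map_tens tensDr tensNr.
Qed.

Fact induction_cocycle_class (f g : cocycle P N n) :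
  ext_class f = ext_class g ->
  ext_class (induction_cocycle f) = ext_class (induction_cocycle g).
Proof.
move=> /eqP; rewrite -Quotient.idealrBE => /asboolP /induction_coboundary fg.
apply/eqP; rewrite -Quotient.idealrBE -induction_cocycleB; exact/asboolP.
Qed.

Lemma ext_induction_class (f : cocycle P N n) :
  ext_induction (ext_class f) = ext_class (induction_cocycle f).
Proof. by apply: induction_cocycle_class; rewrite /ext_class reprK. Qed.

Fact ext_induction_is_zmod_morphism : zmod_morphism ext_induction.
Proof.
elim/quotW=> f; elim/quotW=> g.
rewrite -[in LHS]raddfB -!/(ext_class _) !ext_induction_class induction_cocycleB.
by rewrite /ext_class raddfB.
Qed.
HB.instance Definition _ := GRing.isZmodMorphism.Build (Ext P N n) (Ext IP IN n)
  ext_induction ext_induction_is_zmod_morphism.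

End ExtInduction.
End InducedResolution.

Arguments ext_induction {B L iota} hL {M} P N n x.

(* Main.v *)
(* The functor W (x)_B - is left adjoint to Lambda (x)_B -, so for a projective *)
(* resolution P of X the complex Hom_Lambda(Lambda (x) P, Lambda (x) N) is      *)
(* Hom_B(W (x) P, N), and the map induced by induction is composition with      *)
(* eps (x) P : W (x) P -> P. Write K = ker eps. As Lambda is a generator, eps   *)
(* is onto, so 0 -> K (x) P -> W (x) P -> P -> 0 is exact, degreewise split.    *)
(* In the long exact sequence of Hom(-, N), surjectivity in degree 1 and        *)
(* injectivity in degree 2 force H^1(Hom_B(K (x) P, N)) = 0 for all N (no       *)
(* flatness of W is needed, since resolutions are tensored instead of X). For   *)
(* N = K (x) Omega X, the vanishing of the class of K (x) P_1 -> K (x) Omega X  *)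
(* gives a retraction of K (x) Omega X -> K (x) P_0. The cokernel K (x) X is    *)
(* thus a direct summand of K (x) P_0, itself a summand of the projective       *)
(* module W (x) P_0.                                                            *)

(* [counit_split] gives w in W with eps(w) = 1, so 0 -> K (x) P -> W (x) P -> P -> 0 is exact for
   every left B-module P, where K = ker eps. The adjunction ([dual_transpose_inj],
   [dual_transpose_onto]) turns cochains between induced modules into cochains on W (x) P, and by
   [dual_transpose_induction] the induced cochains become those that factor through eps (x) P. Hence
   the two halves of the Ext hypothesis become [coboundary_of_dual_coboundary] and
   [dual_cocycle_decomposition], and a diagram chase in the long exact sequence,
   [counit_kernel_coboundary], kills H^1 of Hom(K (x) P, N). Applied to the tautological cocycle
   with values in K (x) Omega X, this splits K (x) P_0 -> K (x) X. Finally, K (x) P_0 is projective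
   as a summand of W (x) P_0, by [ker_tensor_retraction] and [dual_tensor_projective]. *)
Require Import Defs.
From HB Require Import structures.
From mathcomp Require Import all_boot all_order all_algebra.
From mathcomp Require Import generic_quotient ring_quotient boolp.

Set Implicit Arguments.
Unset Strict Implicit.
Unset Printing Implicit Defensive.

Import GRing.Theory.
Local Open Scope ring_scope.

(** * Linear maps: factorisations, splittings and quotients *)

Section LinearMaps.
Variable R : pzRingType.

Lemma mk_linear (U V : lmodType R) (f : U -> V) :
  linear f -> exists g : {linear U -> V}, forall x, g x = f x.
Proof.
move=> fL.
by exists (HB.pack_for {linear U -> V} f (GRing.isLinear.Build _ _ _ _ _ fL)).
Qed.

Lemma factor_surj (U V N : lmodType R) (q : {linear U -> V}) (f : {linear U -> N}) :
  surj q -> (forall x, q x = 0 -> f x = 0) ->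
  exists g : {linear V -> N}, forall x, g (q x) = f x.
Proof.
move=> /choice[s qs] fq.
have fE x y : q x = q y -> f x = f y.
  by move=> qxy; apply/eqP; rewrite -subr_eq0 -linearB fq // linearB qxy subrr.
have [|g gE] := @mk_linear V N (f \o s).
  by move=> a x y /=; rewrite -linearP; apply: fE; rewrite linearP !qs.
by exists g => x; rewrite gE; apply: fE; rewrite qs.
Qed.

Lemma projective_retract (P Q : lmodType R) (s : {linear Q -> P}) (r : {linear P -> Q}) :
  (forall x, r (s x) = x) -> projective P -> projective Q.
Proof.
move=> rs projP X Y g f g_surj; have [h gh] := projP _ _ g (f \o r) g_surj.
by exists (h \o s) => x /=; rewrite gh /= rs.
Qed.

(** A section s of q exists by projectivity; t - s(q t) lies in ker q = im j, and its unique
    preimage under j is the value of the retraction at t. *)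
Lemma split_retraction (K U P : lmodType R) (j : {linear K -> U}) (q : {linear U -> P}) :
  injective j -> surj q -> (forall t, q t = 0 <-> exists s, j s = t) ->
  projective P -> exists r : {linear U -> K}, forall x, r (j x) = x.
Proof.
move=> j_inj q_surj jq projP.
have [s qs] := projP _ _ q (idfun : {linear P -> P}) q_surj.
have /choice[r jr] t : exists k, j k = t - s (q t).
  by apply/jq; rewrite linearB qs subrr.
have [|r' r'E] := @mk_linear U K r.
  move=> a x y; apply: j_inj; rewrite linearP !jr !linearP /=.
  by rewrite scalerDr addrACA.
exists r' => x; rewrite r'E; apply: j_inj; rewrite jr.
have -> : q (j x) = 0 by apply/jq; exists x.
by rewrite linear0 subr0.
Qed.

(** Serves to form B/eps(W) as a right B-module. Scalars act through representatives, which is well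
    defined because S is stable under scaling. *)
Lemma quotient_module (M : lmodType R) (S : {pred M}) : submod_closed S ->
  exists (Y : lmodType R) (g : {linear M -> Y}), forall x, g x = 0 <-> x \in S.
Proof.
move=> [S0 SP].
have SZ a x : x \in S -> a *: x \in S by move=> xS; rewrite -[_ *: _]addr0 SP.
have zS : zmod_closed S.
  by split=> // x y xS yS; rewrite addrC -scaleN1r SP.
pose S' := HB.pack_for (zmodClosed M) S (GRing.isZmodClosed.Build M S zS).
pose Q := Quotient.quot S'; pose p (x : M) : Q := (\pi_Q x)%qT.
have pE x y : p x = p y <-> x - y \in S.
  by split=> [/eqP|xy]; [|apply/eqP]; rewrite -Quotient.idealrBE.
pose sc (a : R) (y : Q) : Q := p (a *: repr y).
have scE a x : sc a (p x) = p (a *: x).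
  apply/pE; rewrite -scalerBr SZ //; apply/pE.
  by rewrite /p reprK.
have pD x y : p (x + y) = p x + p y by rewrite /p raddfD.
have scA a b y : sc a (sc b y) = sc (a * b) y.
  by elim/quotW: y => y; rewrite -/(p y) !scE scalerA.
have sc1 : left_id 1 sc by move=> y; elim/quotW: y => y; rewrite -/(p y) scE scale1r.
have scDr : right_distributive sc +%R.
  move=> a; elim/quotW=> x; elim/quotW=> y.
  by rewrite -/(p x) -/(p y) -pD !scE scalerDr pD.
have scDl y : {morph sc^~ y : a b / a + b}.
  by move=> a b; elim/quotW: y => y; rewrite -/(p y) !scE scalerDl pD.
pose Y : lmodType R := HB.pack_for (lmodType R) Q
  (GRing.Zmodule_isLmodule.Build R Q scA sc1 scDr scDl).
have [|g gE] := @mk_linear M Y p.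
  by move=> a x y; rewrite pD -scE.
have p0 : p 0 = 0 by apply: (addIr (p 0)); rewrite -pD !add0r.
by exists Y, g => x; rewrite gE -[0 in X in X <-> _]p0 pE subr0.
Qed.

End LinearMaps.

(** * Maps out of tensor products and right exactness *)

Lemma tensor_comp_ext (A B : pzRingType) (U : bimodule A B) (X : lmodType B)
    (V V' Y : lmodType A) (f : {linear tensor U X -> V}) (f' : {linear tensor U X -> V'})
    (g : {linear V -> Y}) (g' : {linear V' -> Y}) :
  (forall u x, g (f (tens u x)) = g' (f' (tens u x))) -> forall t, g (f t) = g' (f' t).
Proof. by move=> gf; exact: (@tensor_lin_ext _ _ _ _ _ (g \o f) (g' \o f')). Qed.

(** Right exactness of U (x) -. The descended map is built from a set-theoretic section of q; the
    hypothesis on e makes the choice irrelevant, hence the result linear. *)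
Lemma tensor_descend (A B : pzRingType) (U : bimodule A B) (X Y : lmodType B)
    (V : lmodType A) (q : {linear X -> Y}) (e : {linear tensor U X -> V}) :
  surj q -> (forall u x, q x = 0 -> e (tens u x) = 0) ->
  exists s : {linear tensor U Y -> V}, forall t, s (tensor_map U q t) = e t.
Proof.
move=> /choice[s qs] eq0.
have eE u x y : q x = q y -> e (tens u x) = e (tens u y).
  move=> qxy; apply/eqP; rewrite -subr_eq0 -linearB -tensNr -tensDr eq0 //.
  by rewrite linearB qxy subrr.
pose f u y := e (tens u (s y)).
have fDl u v y : f (u + v) y = f u y + f v y by rewrite /f tensDl linearD.
have fDr u x y : f u (x + y) = f u x + f u y.
  by rewrite /f -linearD -tensDr; apply: eE; rewrite linearD !qs.
have fM u b y : f (ract u b) y = f u (b *: y).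
  by rewrite /f tensM; apply: eE; rewrite linearZ /= !qs.
have fZ a u y : f (a *: u) y = a *: f u y by rewrite /f -tensZ linearZ.
pose T := tensor_linear fDl fDr fM fZ.
exists T; apply: (@tensor_lin_ext _ _ _ _ _ (T \o tensor_map U q)) => u x.
rewrite -[LHS]/(T (tensor_map U q (tens u x))) tensor_map_tens.
by rewrite tensor_linear_tens; apply: eE; rewrite qs.
Qed.

Lemma tensor_map_comp0 (A B : pzRingType) (U : bimodule A B) (X Y Z : lmodType B)
    (f : {linear X -> Y}) (g : {linear Y -> Z}) :
  (forall x, g (f x) = 0) -> forall t, tensor_map U g (tensor_map U f t) = 0.
Proof.
move=> gf0; apply: (tensor_comp_ext (f' := \0) (g' := idfun)) => u x.
by rewrite !tensor_map_tens gf0 tens0r.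
Qed.

Lemma tensor_map_surj (A B : pzRingType) (U : bimodule A B) (X Y : lmodType B)
    (q : {linear X -> Y}) : surj q -> surj (tensor_map U q).
Proof.
move=> q_surj; apply: tensor_elim => [|s t [s' <-] [t' <-]|u y].
- by exists 0; rewrite linear0.
- by exists (s' + t'); rewrite linearD.
- by have [x <-] := q_surj y; exists (tens u x); exact: tensor_map_tens.
Qed.

Lemma ext_class_eq (R : pzRingType) (M N : lmodType R) (P : proj_resolution M) n
    (f g : cocycle P N n) :
  ext_class f = ext_class g <-> is_coboundary (cocycle_val f - cocycle_val g).
Proof.
split=> [/eqP|fg]; first by rewrite -Quotient.idealrBE => /asboolP.
by apply/eqP; rewrite -Quotient.idealrBE; exact/asboolP.
Qed.

(** * The exact sequence of a bimodule map eps : U -> B *)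

Section BimoduleOverRing.
Variables (B : pzRingType) (U : bimodule B B) (eps : {linear U -> regular_bimodule B}).
Hypothesis eps_ract : forall u b, eps (ract u b) = ract (eps u) b.
Local Notation K := (ker_bimodule eps_ract).

(** This is eps (x) P followed by the identification of B (x) P with P. *)
Definition eps_map (P : lmodType B) : {linear tensor U P -> P}.
Proof.
refine (@tensor_linear B B U P P (fun u p => (eps u : B) *: p) _ _ _ _).
- by move=> u v p; rewrite linearD scalerDl.
- by move=> u p q; rewrite scalerDr.
- by move=> u b p; rewrite eps_ract scalerA.
- by move=> a u p; rewrite linearZ scalerA.
Defined.

Lemma eps_map_tens P u p : eps_map P (tens u p) = (eps u : B) *: p.
Proof. exact: tensor_linear_tens. Qed.

Lemma eps_map_natural (P Q : lmodType B) (f : {linear P -> Q}) t :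
  eps_map Q (tensor_map U f t) = f (eps_map P t).
Proof.
apply: tensor_comp_ext => u p.
by rewrite tensor_map_tens !eps_map_tens linearZ.
Qed.

Definition ker_tensor (P : lmodType B) : {linear tensor K P -> tensor U P}.
Proof.
refine (@tensor_linear B B K P (tensor U P) (fun u p => tens (ker_val u) p) _ _ _ _).
- by move=> u v p; exact: tensDl.
- by move=> u p q; exact: tensDr.
- by move=> u b p; exact: tensM.
- by move=> a u p; rewrite tensZ.
Defined.

Lemma ker_tensor_tens P (u : K) p : ker_tensor P (tens u p) = tens (ker_val u) p.
Proof. exact: tensor_linear_tens. Qed.

Lemma ker_tensor_natural (P Q : lmodType B) (f : {linear P -> Q}) t :
  ker_tensor Q (tensor_map K f t) = tensor_map U f (ker_tensor P t).
Proof.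
apply: tensor_comp_ext => u p.
by rewrite tensor_map_tens !ker_tensor_tens tensor_map_tens.
Qed.

Lemma eps_ker_tensor P t : eps_map P (ker_tensor P t) = 0.
Proof.
apply: (@tensor_lin_ext _ _ _ _ _ (eps_map P \o ker_tensor P) \0) => u p.
rewrite -[LHS]/(eps_map P (ker_tensor P (tens u p))) ker_tensor_tens eps_map_tens.
by rewrite ker_valP scale0r.
Qed.

Variable w : U.
Hypothesis eps_w : (eps w : B) = 1.

Lemma eps_map_surj P : surj (eps_map P).
Proof. by move=> p; exists (tens w p); rewrite eps_map_tens eps_w scale1r. Qed.

(* The map [u |-> u - w eps(u)] is a right linear retraction of U onto K, so  *)
(* tensoring it with P splits [ker_tensor P] additively.                      *)
Lemma ker_tensor_splitting P : exists r : tensor U P -> tensor K P,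
  (forall t, r (ker_tensor P t) = t) /\
  (forall t, ker_tensor P (r t) = t - tens w (eps_map P t)).
Proof.
pose k0 u : U := u - ract w (eps u : B).
have k0P u : k0 u \in ker_pred eps.
  rewrite unfold_in /k0 linearB eps_ract; apply/eqP.
  by rewrite -[ract _ _]/((eps w : B) * (eps u : B)) eps_w mul1r subrr.
pose k u : K := KerElt (k0P u).
have kD u v : k (u + v) = k u + k v.
  apply: val_inj; rewrite /= /k0 linearD ractDr.
  by rewrite opprD addrACA.
have kM u b : k (ract u b) = ract (k u) b.
  apply: val_inj; rewrite /= /k0 eps_ract.
  have -> : ract w (ract (eps u) b : B) = ract (ract w (eps u : B)) b by exact: ractM.
  have ractN (a c : U) : ract (a - c) b = ract a b - ract c b.
    by apply/eqP; rewrite eq_sym subr_eq -ractDl subrK.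
  by rewrite ractN.
pose f u p : tensor K P := tens (k u) p.
have fDl u v p : f (u + v) p = f u p + f v p by rewrite /f kD tensDl.
have fDr u p q : f u (p + q) = f u p + f u q by exact: tensDr.
have fM u b p : f (ract u b) p = f u (b *: p) by rewrite /f kM tensM.
have rD := tensor_liftD fDl fDr fM.
have rT := tensor_lift_tens fDl fDr fM.
have r0 : tensor_lift f 0 = 0.
  by apply: (addIr (tensor_lift f 0)); rewrite -rD !add0r.
exists (tensor_lift f); split; apply: tensor_elim => [|s t hs ht|u p].
- by rewrite linear0 r0.
- by rewrite linearD rD hs ht.
- rewrite ker_tensor_tens rT /f; congr tens; apply: val_inj.
  by rewrite /= /k0 ker_valP -[RHS]subr0; congr (_ - _);
     apply: (addIr (ract w 0)); rewrite -ractDr !add0r.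
- by rewrite r0 !linear0 tens0r subr0.
- by rewrite rD !linearD hs ht tensDr opprD addrACA.
- by rewrite rT /f ker_tensor_tens eps_map_tens -[ker_val _]/(k0 u) tensDl tensNl tensM.
Qed.

Lemma ker_tensor_inj P : injective (ker_tensor P).
Proof. by have [r [rK _]] := ker_tensor_splitting P; exact: can_inj rK. Qed.

Lemma ker_tensor_exact P t : eps_map P t = 0 <-> exists s, ker_tensor P s = t.
Proof.
split=> [t0|[s <-]]; last exact: eps_ker_tensor.
have [r [_ rE]] := ker_tensor_splitting P.
by exists (r t); rewrite rE t0 tens0r subr0.
Qed.

Lemma ker_tensor_retraction P : projective P ->
  exists r : {linear tensor U P -> tensor K P}, forall t, r (ker_tensor P t) = t.
Proof.
exact: split_retraction (@ker_tensor_inj P) (@eps_map_surj P) (@ker_tensor_exact P).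
Qed.

End BimoduleOverRing.

(** * The adjunction between W (x) - and induction *)

Section DualAdjunction.
Variables (B L : pzRingType) (iota : {rmorphism B -> L}).
Local Notation W := (right_dual iota).
Local Notation LB := (rmod (ext_bimodule iota)).
Local Notation IN N := (induction iota N).

(** The image of eps is the trace ideal of Lambda: f(x) = eps(f(x -)) for every right linear f. If
    it were a proper right ideal, the projection of B onto the quotient would be a nonzero map
    killed by every map from the generator. *)
Lemma counit_split : generator LB -> exists w : W, (counit w : B) = 1.
Proof.
move=> genL; apply: contrapT => no_w.
pose S : {pred rmod (regular_bimodule B)} := fun y => `[< exists u : W, counit u = y >].
have closedS : submod_closed S.
  split=> [|a x y /asboolP[u <-] /asboolP[v <-]]; apply/asboolP.
    by exists 0; exact: linear0.
  by exists (ract u (a : B) + v); rewrite linearD; congr (_ + _); exact: counit_ract.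
have [Y [g gE]] := quotient_module closedS.
have [|f [x /eqP[]]] := genL _ _ g.
  by exists (1 : B); apply/eqP => /gE/asboolP[w w1]; apply: no_w; exists w.
(* This functional has counit f(x), so f(x) lies in S. *)
pose h (y : L) : B := dual_app f (x * y).
have hD y z : h (y + z) = h y + h z by rewrite /h mulrDr dual_appD.
have hM y b : h (y * iota b) = h y * b by rewrite /h mulrA dual_appM.
apply/gE/asboolP; exists (dual_build hD hM : W).
by rewrite -[LHS]/(dual_app f (x * 1)) mulr1.
Qed.

Section Contract.
Variable N : lmodType B.

(** The evaluation W (x) (Lambda (x) N) -> N at a fixed u, that is, the counit of the adjunction. *)
Definition contract (u : W) : IN N -> N :=
  tensor_lift (fun (x : ext_bimodule iota) n => dual_app u x *: n).

Let contract_hyp (u : W) :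
  [/\ forall x y (n : N), dual_app u (x + y) *: n = dual_app u x *: n + dual_app u y *: n,
      forall x (m n : N), dual_app u x *: (m + n) = dual_app u x *: m + dual_app u x *: n &
      forall x b (n : N), dual_app u (x * iota b) *: n = dual_app u x *: (b *: n)].
Proof. by split=> *; rewrite ?dual_appD ?scalerDl ?scalerDr ?dual_appM ?scalerA. Qed.

Lemma contract_tens u (x : ext_bimodule iota) n :
  contract u (tens x n) = dual_app u x *: n.
Proof. by have [h1 h2 h3] := contract_hyp u; exact: tensor_lift_tens. Qed.

Lemma contractD u s t : contract u (s + t) = contract u s + contract u t.
Proof. by have [h1 h2 h3] := contract_hyp u; exact: tensor_liftD. Qed.

Lemma contract0 u : contract u 0 = 0.
Proof. by apply: (addIr (contract u 0)); rewrite -contractD !add0r. Qed.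

Lemma contract_sum u (I : Type) (r : seq I) (F : I -> IN N) :
  contract u (\sum_(i <- r) F i) = \sum_(i <- r) contract u (F i).
Proof.
by elim: r => [|i r IH]; rewrite ?big_nil ?contract0 // !big_cons contractD IH.
Qed.

Lemma contractDl (u v : W) t : contract (u + v) t = contract u t + contract v t.
Proof.
elim/tensor_elim: t => [|s t hs ht|x n]; first by rewrite !contract0 addr0.
  by rewrite !contractD hs ht addrACA.
by rewrite !contract_tens -scalerDl.
Qed.

Lemma contractZ b (u : W) t : contract (b *: u) t = b *: contract u t.
Proof.
elim/tensor_elim: t => [|s t hs ht|x n]; first by rewrite !contract0 scaler0.
  by rewrite !contractD hs ht scalerDr.
by rewrite !contract_tens scalerA.
Qed.

Lemma contract_ract (u : W) b t : contract (ract u b) t = contract u (iota b *: t).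
Proof.
elim/tensor_elim: t => [|s t hs ht|x n]; first by rewrite scaler0 !contract0.
  by rewrite scalerDr !contractD hs ht.
by rewrite tensZ !contract_tens.
Qed.

End Contract.

Lemma contract_natural (M N : lmodType B) (f : {linear M -> N}) u t :
  contract u (induction_map iota f t) = f (contract u t).
Proof.
elim/tensor_elim: t => [|s t hs ht|x n].
- by rewrite linear0 !contract0 linear0.
- by rewrite linearD !contractD linearD hs ht.
- by rewrite tensor_map_tens !contract_tens linearZ.
Qed.

(** Both expansions come from x = sum e_i phi_i(x): apply u to it, or tensor it with N. They act as
    the triangle identities of the adjunction. *)
Lemma contract_basis : fg_projective LB ->
  exists (n : nat) (e : 'I_n -> ext_bimodule iota) (phi : 'I_n -> W),
    (forall u : W, u = \sum_i dual_app u (e i) *: phi i) /\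
    (forall (N : lmodType B) (t : IN N), t = \sum_i tens (e i) (contract (phi i) t)).
Proof.
move=> /dual_basis[n [e [phi e_phi]]]; exists n, e, phi; split=> [u|N].
  apply: dual_app_ext => x; rewrite [in LHS](e_phi x).
  elim: (index_enum _) => [|i r IH].
    by rewrite !big_nil; exact: (linear0 (u : {linear LB -> rmod (regular_bimodule B)})).
  by rewrite !big_cons dual_appD dual_appM IH.
apply: tensor_elim => [|s t hs ht|x m].
- by rewrite big1 // => i _; rewrite contract0 tens0r.
- rewrite {1}hs {1}ht -big_split; apply: eq_bigr => i _.
  by rewrite contractD tensDr.
- under eq_bigr => i _ do rewrite contract_tens -tensM.
  rewrite {1}(e_phi x); elim: (index_enum _) => [|i r IH].
    by rewrite !big_nil tens0l.
  by rewrite !big_cons tensDl IH.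
Qed.

Section Transpose.
Variables P N : lmodType B.

(* [dual_transpose] and its inverse realise Hom_L(L (x)_B P, L (x)_B N) =     *)
(* Hom_B(W (x)_B P, N): both functors of P and N are Hom_B(P, L (x)_B N).     *)
Definition dual_transpose (a : {linear IN P -> IN N}) : {linear tensor W P -> N}.
Proof.
refine (@tensor_linear B B W P N
  (fun u p => contract u (a (tens (1 : ext_bimodule iota) p))) _ _ _ _).
- by move=> u v p; exact: contractDl.
- by move=> u p q; rewrite tensDr linearD contractD.
- move=> u b p; rewrite contract_ract -linearZ /= tensZ -tensM /=.
  by rewrite /GRing.scale /= mul1r mulr1.
- by move=> b u p; exact: contractZ.
Defined.

Lemma dual_transpose_tens a (u : W) p :
  dual_transpose a (tens u p) = contract u (a (tens (1 : ext_bimodule iota) p)).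
Proof. exact: tensor_linear_tens. Qed.

Lemma dual_transposeB a a' t :
  dual_transpose (a - a') t = dual_transpose a t - dual_transpose a' t.
Proof.
apply/eqP; rewrite eq_sym subr_eq; apply/eqP; move: t.
apply: (@tensor_lin_ext _ _ _ _ _ _ (dual_transpose (a - a') + dual_transpose a')) => u p.
rewrite -[RHS]/(dual_transpose (a - a') (tens u p) + dual_transpose a' (tens u p)).
rewrite !dual_transpose_tens -contractD.
by rewrite -[(a - a') _]/(a (tens _ p) - a' (tens _ p)) subrK.
Qed.

Hypothesis hL : fg_projective LB.

(** The elements 1 (x) p generate the source over Lambda, and the dual basis coordinates of a(1 (x)
    p) are the values of the transpose at phi_i (x) p. *)
Lemma dual_transpose_inj a a' :
  (forall t, dual_transpose a t = dual_transpose a' t) -> forall t, a t = a' t.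
Proof.
have [n [e [phi [_ tE]]]] := contract_basis hL.
move=> aa'; apply: tensor_lin_ext => x p.
have -> : tens x p = (x : L) *: tens (1 : ext_bimodule iota) p :> IN P.
  by rewrite tensZ; congr tens; rewrite /GRing.scale /= mulr1.
rewrite !linearZ /= [a _ in LHS]tE [a' _ in RHS]tE; congr (_ *: _).
by apply: eq_bigr => i _; rewrite -!dual_transpose_tens aa'.
Qed.

Lemma dual_transpose_onto (b : {linear tensor W P -> N}) :
  exists a, forall t, dual_transpose a t = b t.
Proof.
have [n [e [phi [uE tE]]]] := contract_basis hL.
(* The unit sum e_i (x) phi_i of the adjunction, pushed through b. *)
pose h p : restriction iota (IN N) := \sum_i tens (e i) (b (tens (phi i) p)).
have hE (u : W) p : contract u (h p) = b (tens u p).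
  rewrite contract_sum [u in RHS]uE.
  elim: (index_enum _) => [|i r IH]; first by rewrite !big_nil tens0l linear0.
  by rewrite !big_cons IH tensDl linearD contract_tens -tensZ linearZ.
have [|h' h'E] := @mk_linear _ P (restriction iota (IN N)) h.
  move=> c p q.
  have -> : h (c *: p + q) = h (c *: p) + h q.
    by rewrite /h -big_split; apply: eq_bigr => i _; rewrite tensDr linearD tensDr.
  (* Scalars pass across the dual basis because phi_i(c h(p)) = (phi_i c)(h(p)) = b(phi_i c (x) p) =
     b(phi_i (x) c p). *)
  congr (_ + _); rewrite -[RHS]/(iota c *: (h p : IN N)) [RHS]tE.
  by apply: eq_bigr => i _; rewrite -contract_ract hE tensM.
exists (adj_counit h'); apply: tensor_lin_ext => u p.
by rewrite dual_transpose_tens adj_counit_tens scale1r h'E hE.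
Qed.

End Transpose.

Lemma dual_transpose_comp (P Q N : lmodType B) (d : {linear P -> Q})
    (a : {linear IN Q -> IN N}) (a' : {linear IN P -> IN N}) :
  (forall t, a' t = a (induction_map iota d t)) ->
  forall t, dual_transpose a' t = dual_transpose a (tensor_map W d t).
Proof.
move=> a'E; apply: (tensor_comp_ext (f := idfun) (g := dual_transpose a')) => u p.
by rewrite tensor_map_tens !dual_transpose_tens a'E tensor_map_tens.
Qed.

Lemma dual_transpose_induction (P N : lmodType B) (f : {linear P -> N}) t :
  dual_transpose (induction_map iota f) t = f (eps_map (@counit_ract _ _ iota) P t).
Proof.
move: t; apply: (tensor_comp_ext (f := idfun) (g := dual_transpose _)) => u p.
by rewrite eps_map_tens dual_transpose_tens tensor_map_tens contract_tens linearZ.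
Qed.

(** A left adjoint preserves projectives when its right adjoint preserves surjections: transpose f,
    lift it through the induced surjection, and transpose back. *)
Lemma dual_tensor_projective (P : lmodType B) : fg_projective LB ->
  projective P -> projective (tensor W P).
Proof.
move=> hL projP Y Z g f g_surj.
have [a aE] := dual_transpose_onto hL f.
have [b bE] := induction_projective projP a (induction_surj g_surj).
exists (dual_transpose b) => t; rewrite -aE; move: t.
apply: (tensor_comp_ext (f' := idfun) (g' := dual_transpose a)) => u p.
by rewrite !dual_transpose_tens -contract_natural bE.
Qed.

(** * The Ext hypotheses read on W (x) P *)

Section ExtTranspose.
Hypothesis hL : fg_projective LB.
Variables (M : lmodType B) (P : proj_resolution M) (N : lmodType B) (n : nat).
Local Notation eps_W := (eps_map (@counit_ract _ _ iota)).
Local Notation IP := (induced_resolution hL P).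

(** Injectivity on Ext: a cocycle whose pullback along eps bounds on W (x) P already bounds on P. *)
Lemma coboundary_of_dual_coboundary (g : {linear P n.+1 -> N})
    (b : {linear tensor W (P n) -> N}) :
  injective (ext_induction hL P N n.+1) ->
  (forall x, g (res_d P n.+1 x) = 0) ->
  (forall t, g (eps_W (P n.+1) t) = b (tensor_map W (res_d P n) t)) ->
  exists h : {linear P n -> N}, forall x, g x = h (res_d P n x).
Proof.
move=> ext_inj gd gb.
have g_cocycle : g \in @cocycles _ _ P N n.+1 by apply/asboolP.
have [a aE] := dual_transpose_onto hL b.
pose c := Cocycle g_cocycle.
suff /ext_class_eq[h hE] : ext_class c = ext_class 0.
  by exists h => x; rewrite -hE /= subr0.
apply: ext_inj; rewrite !ext_induction_class; apply/ext_class_eq.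
have map0 t : induction_map iota (0 : {linear P n.+1 -> N}) t = 0.
  move: t; apply: (@tensor_lin_ext _ _ _ _ _ (induction_map iota 0) \0) => u x.
  by rewrite tensor_map_tens tens0r.
(* The cochain [a] whose transpose is [b] bounds the induced cocycle; this may be checked after
   transposing. *)
exists a => t.
rewrite -[LHS]/(induction_map iota g t - induction_map iota 0 t) map0 subr0; move: t.
pose ad : {linear IN (P n.+1) -> IN N} := a \o induction_map iota (res_d P n).
apply: (@dual_transpose_inj _ _ hL (induction_map iota g) ad) => t.
by rewrite dual_transpose_induction gb -aE; apply/esym/dual_transpose_comp.
Qed.

(** Surjectivity on Ext: up to a coboundary, every cocycle on W (x) P is pulled back along eps. *)
Lemma dual_cocycle_decomposition (b : {linear tensor W (P n.+1) -> N}) :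
  surj (ext_induction hL P N n.+1) ->
  (forall t, b (tensor_map W (res_d P n.+1) t) = 0) ->
  exists (h : {linear P n.+1 -> N}) (l : {linear tensor W (P n) -> N}),
    forall t, b t = h (eps_W (P n.+1) t) + l (tensor_map W (res_d P n) t).
Proof.
move=> ext_surj bd; have [a aE] := dual_transpose_onto hL b.
have a_cocycle : (a : {linear IP n.+1 -> IN N}) \in @cocycles _ _ IP (IN N) n.+1.
  apply/asboolP.
  pose ad : {linear IN (P n.+2) -> IN N} := a \o induction_map iota (res_d P n.+1).
  apply: (@dual_transpose_inj _ _ hL ad 0) => t.
  rewrite (dual_transpose_comp (d := res_d P n.+1) (a := a)) // aE bd; apply/esym; move: t.
  apply: (@tensor_lin_ext _ _ _ _ _ (dual_transpose 0) \0) => u p.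
  by rewrite dual_transpose_tens contract0.
have [x] := ext_surj (ext_class (Cocycle a_cocycle)).
elim/quotW: x => c; rewrite -/(ext_class c) ext_induction_class => /ext_class_eq[l lE].
(* The sign arises because [l] bounds the induced cocycle of [c] minus [a]. *)
exists c, (- dual_transpose l) => t.
pose ld : {linear IN (P n.+1) -> IN N} := l \o induction_map iota (res_d P n).
have -> : b t = dual_transpose (induction_map iota c - ld) t.
  rewrite -aE; congr (dual_transpose _ t); apply: lin_ext => x.
  by rewrite -[RHS]/(induction_map iota c x - l (res_d IP n x)) -lE subKr.
rewrite dual_transposeB dual_transpose_induction; congr (_ - _).
exact: dual_transpose_comp.
Qed.

End ExtTranspose.

(** The long exact sequence by hand: the connecting map sends the class of [f] to the kernel of the
    degree 2 map, which is zero, so [f] extends to a cocycle on W (x) P_1; surjectivity in degree 1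
    then makes [f] a coboundary. *)
Lemma counit_kernel_coboundary (hL : fg_projective LB) (w : W)
    (M : lmodType B) (P : proj_resolution M) (N : lmodType B) :
  (counit w : B) = 1 ->
  surj (ext_induction hL P N 1) -> injective (ext_induction hL P N 2) ->
  forall f : {linear tensor (counit_kernel iota) (P 1) -> N},
  (forall t, f (tensor_map (counit_kernel iota) (res_d P 1) t) = 0) ->
  exists r : {linear tensor (counit_kernel iota) (P 0) -> N},
    forall t, f t = r (tensor_map (counit_kernel iota) (res_d P 0) t).
Proof.
move=> w1 ext_surj ext_inj f fd.
have j_exact Q := ker_tensor_exact (@counit_ract _ _ iota) w1 (P := Q).
have eps_surj Q := eps_map_surj (@counit_ract _ _ iota) w1 (P := Q).
have eps_nat := eps_map_natural (@counit_ract _ _ iota).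
have j_nat (Q Q' : lmodType B) (d : {linear Q -> Q'}) := ker_tensor_natural (eps_ract := @counit_ract _ _ iota) d.
have dd x : res_d P 1 (res_d P 2 x) = 0 by apply/res_exactS; exists x.
have [ret retE] := ker_tensor_retraction (@counit_ract _ _ iota) w1
  (@res_projective _ _ P 1).
pose f1 : {linear tensor W (P 1) -> N} := f \o ret.
pose f2 : {linear tensor W (P 2) -> N} := f1 \o tensor_map W (res_d P 1).
(* [g] represents the image of [f] under the connecting map; [f2] vanishes on K (x) P_2 since [f] is
   a cocycle. *)
have [|g gE] := factor_surj (@eps_surj (P 2)) (f := f2).
  by move=> t /j_exact[s <-]; rewrite /f2 /f1 /= -j_nat retE fd.
have gd x : g (res_d P 2 x) = 0.
  have [t <-] := @eps_surj _ x.
  by rewrite -eps_nat gE /f2 /= (tensor_map_comp0 dd) !linear0.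
have [h hE] := coboundary_of_dual_coboundary ext_inj gd gE.
pose h_eps : {linear tensor W (P 1) -> N} := h \o eps_map (@counit_ract _ _ iota) (P 1).
(* Subtracting h o eps makes the extension [f1] a cocycle and keeps its restriction to K (x) P_1,
   where eps vanishes. *)
pose f3 : {linear tensor W (P 1) -> N} := f1 - h_eps.
have f3E t : f3 t = f (ret t) - h (eps_map (@counit_ract _ _ iota) (P 1) t) by [].
have [|h' [l lE]] := dual_cocycle_decomposition (b := f3) ext_surj.
  by move=> t; rewrite f3E eps_nat -hE gE subrr.
pose j0 := ker_tensor (@counit_ract _ _ iota) (P 0).
exists (l \o j0) => t.
have := lE (ker_tensor (@counit_ract _ _ iota) _ t).
by rewrite f3E retE !eps_ker_tensor !linear0 addr0 add0r -j_nat => ->.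
Qed.

End DualAdjunction.

(** * Splitting K (x) X off K (x) P_0 *)

Theorem theorem2p13 (k : comNzRingType) (Lambda : algType k)
    (S : {pred Lambda}) (B : subAlgType S)
    (Lambda_fgproj : fg_projective (rmod (ext_bimodule (inclusion B))))
    (Lambda_gen : generator (rmod (ext_bimodule (inclusion B))))
    (ext_epi : forall (M N : lmodType B) (i : nat), (1 <= i)%N ->
       surj (ext_induction Lambda_fgproj (free_resolution M) N i))
    (ext_iso : forall (M N : lmodType B) (i : nat), (2 <= i)%N ->
       bijective (ext_induction Lambda_fgproj (free_resolution M) N i)) :
  left_projectivising (counit_kernel (inclusion B)).
Proof.
have [w w1] := counit_split Lambda_gen.
move=> X.
set K := counit_kernel _; pose P := free_resolution X.
pose pi : {linear P 1%N -> syzygy X 1} := free_aug (syzygy X 1).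
pose i : {linear syzygy X 1 -> P 0%N} := val : ker (free_aug X) -> free_module X.
have pi_d x : pi (res_d P 1 x) = 0 by exact: ker_valP.
(* The tautological cocycle K (x) P_1 -> K (x) Omega X is a coboundary, so it extends along K (x)
   d_0 to [r]. *)
have [|r rE] := counit_kernel_coboundary w1 (ext_epi X (tensor K (syzygy X 1)) _ (leqnn 1))
  (bij_inj (ext_iso X (tensor K (syzygy X 1)) _ (leqnn 2))) (f := tensor_map K pi).
  exact: tensor_map_comp0.
(* As d_0 = i o pi, the surjection K (x) pi can be cancelled from K (x) pi = r o (K (x) i) o (K (x)
   pi). *)
have r_i t : r (tensor_map K i t) = t.
  have [s <-] := @tensor_map_surj _ _ K _ _ pi (@free_aug_surj _ _) t.
  rewrite [RHS]rE; congr (r _); move: s; apply: (tensor_comp_ext (f' := idfun)) => u x.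
  by rewrite !tensor_map_tens.
pose id0 : {linear tensor K (P 0%N) -> tensor K (P 0%N)} := idfun.
pose i_r : {linear tensor K (P 0%N) -> tensor K (P 0%N)} := tensor_map K i \o r.
(* The idempotent complementary to (K (x) i) o r. It kills the image of K (x) Omega X, so it
   descends to a section of K (x) P_0 -> K (x) X. *)
pose e : {linear tensor K (P 0%N) -> tensor K (P 0%N)} := id0 - i_r.
have eE t : e t = t - tensor_map K i (r t) by [].
have [||s sE] := @tensor_descend _ _ K _ _ _ (free_aug X) e.
- exact: free_aug_surj.
- move=> u x x0.
  have kx : x \in ker_pred (free_aug X) by apply/eqP.
  have -> : tens u x = tensor_map K i (tens u (KerElt kx : syzygy X 1)) :> tensor K _.
    by rewrite tensor_map_tens.
  by rewrite eE r_i subrr.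
apply: (@projective_retract _ (tensor K (P 0%N)) _ s (tensor_map K (free_aug X))).
  move=> t; have [t' <-] := @tensor_map_surj _ _ K _ _ _ (@free_aug_surj _ X) t.
  rewrite sE eE linearB.
  by rewrite tensor_map_comp0 ?subr0 //; exact: ker_valP.
have [ret retE] := ker_tensor_retraction (@counit_ract _ _ (inclusion B)) w1
  (@res_projective _ _ P 0).
apply: projective_retract retE _.
exact: dual_tensor_projective Lambda_fgproj (@res_projective _ _ P 0).
Qed.
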